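(* Let $\nu\ge0$ be real and, for $u>0$, define $g_\nu(u)=\log(\sqrt u\,I_\nu(u))$, $r_\nu(u)=I_\nu'(u)/I_\nu(u)$ and $q_\nu(u)=I_{\nu+1}(u)/I_\nu(u)$. Then for all $u>0$ $$g_\nu''(u)=1+\frac{\nu^2-\frac12}{u^2}-\frac{r_\nu(u)}{u}-r_\nu(u)^2$$ and, equivalently, $$g_\nu''(u)=1-q_\nu(u)^2-\frac{(2\nu+1)\,q_\nu(u)}{u}-\frac{\nu+\frac12}{u^2}.$$ In particular, at any fixed $(\nu,u)$ the following three statements are equivalent: (1) $g_\nu''(u)<0$; (2) $1+\frac{\nu^2-\frac12}{u^2}-\frac{r_\nu(u)}{u}-r_\nu(u)^2<0$; (3) $q_\nu(u)^2+\frac{(2\nu+1)q_\nu(u)}{u}+\frac{\nu+\frac12}{u^2}>1$.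
   Context: $I_\nu$ is the modified Bessel function of the first kind of order $\nu$: for $u>0$, $I_\nu(u)=\sum_{k\ge0}\frac{(u/2)^{2k+\nu}}{k!\,\Gamma(k+\nu+1)}$. Primes denote derivatives in $u$. *)

(* Defs.v *)
From Stdlib Require Import Reals Factorial.
From Coquelicot Require Import Coquelicot.
Open Scope R_scope.

(* Euler's integral; meaningful for [x > 0]. The lower endpoint is approached
   from the right because [Rpower 0 _] carries no meaning (and the integral is
   improper at 0 when [x < 1]). *)
Definition Gamma (x : R) : R :=
  RInt_gen (fun t => Rpower t (x - 1) * exp (- t))
    (at_right 0) (Rbar_locally p_infty).

(* Meaningful for [u > 0], where [Rpower] is the genuine real power; the same
   restriction applies to [bessel_g], [bessel_r] and [bessel_q]. *)
Definition bessel_I (nu u : R) : R :=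
  Series (fun k : nat =>
    Rpower (u / 2) (2 * INR k + nu) /
      (INR (fact k) * Gamma (INR k + nu + 1))).

Definition bessel_g (nu u : R) : R := ln (sqrt u * bessel_I nu u).

Definition bessel_r (nu u : R) : R := Derive (bessel_I nu) u / bessel_I nu u.

Definition bessel_q (nu u : R) : R := bessel_I (nu + 1) u / bessel_I nu u.

(* Main.v *)
Require Import Defs.
From Stdlib Require Import Reals Factorial Lra.
From Coquelicot Require Import Coquelicot.
Open Scope R_scope.

(** Write I_nu(u) = (u/2)^nu P_nu(u^2/4), where P_nu is the entire function with
    coefficients 1 / (k! Gamma(k+nu+1)). The functional equation
    Gamma(x+1) = x Gamma(x) relates the coefficients for nu, nu+1 and nu+2, and
    turns into two identities between power series:
    P_nu' = P_(nu+1)  and  P_nu(x) = x P_(nu+2)(x) + (nu+1) P_(nu+1)(x).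
    In terms of Bessel functions these say
      I_nu'     = (nu/u) I_nu + I_(nu+1)            ([is_derive_bessel_I]),
      I_(nu+1)' = I_nu - ((nu+1)/u) I_(nu+1)        ([is_derive_bessel_I_succ]).
    The first one gives r = nu/u + q, hence g' = 1/(2u) + r = (nu+1/2)/u + q;
    both together give the Riccati equation q' = 1 - q^2 - (2nu+1) q/u
    ([is_derive_bessel_q]). Differentiating g' once more yields the formula in
    q, and substituting q = r - nu/u turns it into the formula in r; the
    equivalences are then rearrangements.

    The analytic input is that Euler's integral converges, is positive, and
    satisfies the functional equation. For x >= 1 convergence follows from
    the bound C exp(-t/2) on the integrand, uniform down to t = 0. For 0 < x
    the integrand for x is a combination of the integrand for x+1 and the
    derivative of t^x exp(-t), whose boundary values vanish; integrating by
    parts therefore gives convergence and the functional equation at once. *)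

(** * Convergence of Euler's integral *)

(** A monotone convergence argument treating both endpoints at once: the
    integral over a segment grows with the segment, so the supremum [l] of these
    values is also their limit. *)
Lemma is_RInt_gen_nonneg_bounded (f : R -> R) (M : R) :
  (forall t, 0 < t -> continuous f t) ->
  (forall t, 0 < t -> 0 <= f t) ->
  (forall a b, 0 < a <= b -> RInt f a b <= M) ->
  exists l,
    is_RInt_gen f (at_right 0) (Rbar_locally p_infty) l /\
    forall a b, 0 < a <= b -> RInt f a b <= l.
Proof.
intros Hc Hpos HM.
assert (Hex : forall a b, 0 < a -> 0 < b -> ex_RInt f a b).
{ intros a b Ha Hb; apply (@ex_RInt_continuous R_CompleteNormedModule).
  intros z [Hz _]; apply Hc.
  apply Rlt_le_trans with (2 := Hz); now apply Rmin_pos. }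
set (E v := exists a b, 0 < a <= b /\ v = RInt f a b).
destruct (completeness E) as [l [Hub Hlub]].
{ exists M; intros v [a [b [Hab ->]]]; now apply HM. }
{ exists (RInt f 1 1), 1, 1; split; [lra | easy]. }
assert (Hle : forall a b, 0 < a <= b -> RInt f a b <= l).
{ intros a b Hab; apply Hub; now exists a, b. }
exists l; split; [| exact Hle].
intros P [eps HP].
assert (Hnear : exists a0 b0, 0 < a0 <= b0 /\ l - eps < RInt f a0 b0).
{ apply Classical_Prop.NNPP; intros Hn.
  assert (l <= l - eps); [| generalize (cond_pos eps); lra].
  apply Hlub; intros v [a [b [Hab ->]]].
  apply Rnot_lt_le; intros Hlt; apply Hn; now exists a, b. }
destruct Hnear as [a0 [b0 [Hab0 Hl0]]].
apply (Filter_prod _ _ _ (fun a => 0 < a < a0) (fun b => b0 < b)).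
- exists (mkposreal a0 (proj1 Hab0)); simpl; intros y Hy Hy0.
  apply Rabs_lt_between' in Hy; lra.
- now exists b0.
- intros a b Ha Hb; simpl; exists (RInt f a b); split.
  { apply (@RInt_correct R_CompleteNormedModule), Hex; lra. }
  apply HP; apply Rabs_lt_between'.
  assert (H1 : 0 <= RInt f a a0).
  { apply RInt_ge_0; [lra | apply Hex; lra | intros; apply Hpos; lra]. }
  assert (H2 : 0 <= RInt f b0 b).
  { apply RInt_ge_0; [lra | apply Hex; lra | intros; apply Hpos; lra]. }
  assert (H3 : RInt f a b = RInt f a a0 + RInt f a0 b0 + RInt f b0 b).
  { rewrite <- (RInt_Chasles f a a0 b), <- (RInt_Chasles f a0 b0 b);
      try (apply Hex; lra).
    unfold plus; simpl; ring. }
  generalize (Hle a b ltac:(lra)) (cond_pos eps); lra.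
Qed.

Definition euler_integrand (x t : R) : R := Rpower t (x - 1) * exp (- t).

Lemma is_derive_Rpower (y t : R) :
  0 < t -> is_derive (fun t => Rpower t y) t (y * Rpower t (y - 1)).
Proof. intros Ht; apply is_derive_Reals; now apply derivable_pt_lim_power. Qed.

Lemma is_derive_euler_integrand (x t : R) :
  0 < t ->
  is_derive (euler_integrand (x + 1)) t
    (x * euler_integrand x t - euler_integrand (x + 1) t).
Proof.
intros Ht; unfold euler_integrand; replace (x + 1 - 1) with x by ring.
generalize (is_derive_Rpower x t Ht); intros H.
evar_last.
apply (is_derive_mult (fun t => Rpower t x) (fun t => exp (- t))).
exact H.
auto_derive; [easy | reflexivity].
intros; apply Rmult_comm.
unfold plus, mult; simpl; ring.
Qed.

Lemma continuous_euler_integrand (x t : R) :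
  0 < t -> continuous (euler_integrand x) t.
Proof.
intros Ht.
apply (ex_derive_continuous (euler_integrand x)).
replace x with (x - 1 + 1) by ring.
eexists; now apply is_derive_euler_integrand.
Qed.

Lemma euler_integrand_pos (x t : R) : 0 < euler_integrand x t.
Proof. apply Rmult_lt_0_compat; apply exp_pos. Qed.

(** The exponential absorbs the power through log y <= y - 1 at y = t/(2x),
    the scale for which the power costs at most half of the exponent. *)
Lemma euler_integrand_le (x : R) :
  1 <= x ->
  exists C, 0 < C /\
    forall t, 0 < t -> euler_integrand x t <= C * exp (- t / 2).
Proof.
intros Hx; exists (Rpower (2 * x) (x - 1)); split; [apply exp_pos |].
intros t Ht; unfold euler_integrand, Rpower; rewrite <- !exp_plus.
assert (Hln : ln t <= t / (2 * x) + ln (2 * x)).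
{ replace (ln t) with (ln (t / (2 * x)) + ln (2 * x)).
  2: { rewrite <- ln_mult; [f_equal; field; lra | apply Rdiv_lt_0_compat; lra | lra]. }
  apply Rplus_le_compat_r.
  assert (Ht' : 0 < t / (2 * x)) by (apply Rdiv_lt_0_compat; lra).
  generalize (exp_ineq1_le (ln (t / (2 * x)))); rewrite exp_ln; lra. }
assert (Hexp : (x - 1) * ln t + - t <= (x - 1) * ln (2 * x) + - t / 2).
{ apply Rmult_le_compat_l with (r := x - 1) in Hln; [| lra].
  assert ((x - 1) * (t / (2 * x)) <= t / 2); [| lra].
  apply Rle_trans with (x * (t / (2 * x))); [| right; field; lra].
  apply Rmult_le_compat_r; [| lra].
  left; apply Rdiv_lt_0_compat; lra. }
destruct Hexp as [H | H]; [left; now apply exp_increasing | rewrite H; apply Rle_refl].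
Qed.

Lemma RInt_euler_integrand_bounded (x : R) :
  1 <= x -> exists M, forall a b, 0 < a <= b -> RInt (euler_integrand x) a b <= M.
Proof.
intros Hx; destruct (euler_integrand_le x Hx) as [C [HC Hle]].
exists (2 * C); intros a b Hab.
assert (Hint : is_RInt (fun t => C * exp (- t / 2)) a b
                 (2 * C * exp (- a / 2) - 2 * C * exp (- b / 2))).
{ evar_last.
  apply (@is_RInt_derive R_CompleteNormedModule
           (fun t => - (2 * C) * exp (- t / 2))).
  - intros t _; auto_derive; [easy | unfold Rdiv; field].
  - intros t _; apply (ex_derive_continuous (fun t => C * exp (- t / 2))).
    now auto_derive.
  - unfold minus, plus, opp; simpl; ring. }
apply Rle_trans with (RInt (fun t => C * exp (- t / 2)) a b).
- apply RInt_le; [lra | | now eexists; apply Hint | intros; apply Hle; lra].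
  apply (@ex_RInt_continuous R_CompleteNormedModule); intros z [Hz _].
  apply continuous_euler_integrand.
  rewrite Rmin_left in Hz; lra.
- rewrite (is_RInt_unique _ _ _ _ Hint).
  assert (exp (- a / 2) <= 1).
  { rewrite <- exp_0; left; apply exp_increasing; lra. }
  replace (2 * C * exp (- a / 2) - 2 * C * exp (- b / 2))
    with (2 * C * (exp (- a / 2) - exp (- b / 2))) by ring.
  rewrite <- (Rmult_1_r (2 * C)) at 2.
  apply Rmult_le_compat_l; [lra | generalize (exp_pos (- b / 2)); lra].
Qed.

Lemma Gamma_unique (x l : R) :
  is_RInt_gen (euler_integrand x) (at_right 0) (Rbar_locally p_infty) l ->
  Gamma x = l.
Proof.
intros Hl.
exact (is_RInt_gen_unique (V := R_CompleteNormedModule) (euler_integrand x) l Hl).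
Qed.

Lemma Gamma_spec_ge_1 (x : R) :
  1 <= x ->
  is_RInt_gen (euler_integrand x) (at_right 0) (Rbar_locally p_infty) (Gamma x) /\
  0 < Gamma x.
Proof.
intros Hx; destruct (RInt_euler_integrand_bounded x Hx) as [M HM].
destruct (is_RInt_gen_nonneg_bounded (euler_integrand x) M) as [l [Hl Hle]].
- apply continuous_euler_integrand.
- intros t _; left; apply euler_integrand_pos.
- exact HM.
- replace (Gamma x) with l.
  2: { symmetry; now apply Gamma_unique. }
  split; [exact Hl |].
  apply Rlt_le_trans with (RInt (euler_integrand x) 1 2); [| apply Hle; lra].
  apply RInt_gt_0; [lra | intros; apply euler_integrand_pos |].
  intros; apply continuous_euler_integrand; lra.
Qed.

Lemma euler_integrand_lim_0 (x : R) :
  0 < x -> filterlim (euler_integrand (x + 1)) (at_right 0) (locally 0).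
Proof.
intros Hx.
apply (filterlim_le_le (fun _ => 0) _ (fun t => exp (x * ln t)) (Finite 0)).
- exists (mkposreal 1 Rlt_0_1); intros t _ Ht; split.
  { left; apply euler_integrand_pos. }
  unfold euler_integrand, Rpower; replace (x + 1 - 1) with x by ring.
  rewrite <- (Rmult_1_r (exp (x * ln t))) at 2.
  apply Rmult_le_compat_l; [left; apply exp_pos |].
  rewrite <- exp_0; left; apply exp_increasing; lra.
- apply filterlim_const.
- apply filterlim_comp with (2 := is_lim_exp_m).
  intros P [m Hm]; apply (is_lim_ln_0 (fun y => P (x * y))); exists (m / x); intros y Hy; apply Hm.
  apply Rmult_lt_compat_l with (r := x) in Hy; [| easy].
  replace (x * (m / x)) with m in Hy by (field; lra); exact Hy.
Qed.

Lemma euler_integrand_lim_infty (x : R) :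
  1 <= x -> filterlim (euler_integrand x) (Rbar_locally p_infty) (locally 0).
Proof.
intros Hx; destruct (euler_integrand_le x Hx) as [C [HC Hle]].
apply (filterlim_le_le (fun _ => 0) _ (fun t => C * exp (- t / 2)) (Finite 0)).
- exists 0; intros t Ht; split; [left; apply euler_integrand_pos | now apply Hle].
- apply filterlim_const.
- change (is_lim (fun t => C * exp (- t / 2)) p_infty 0).
  replace (Finite 0) with (Rbar_mult C 0) by (simpl; f_equal; ring).
  apply is_lim_scal_l.
  apply (is_lim_comp exp (fun t => - t / 2) p_infty 0 m_infty).
  + exact is_lim_exp_m.
  + intros P [m Hm]; exists (- 2 * m); intros t Ht; apply Hm; lra.
  + now exists 0.
Qed.

(** Integration by parts, read from right to left: since
    (t^x e^(-t))' = x t^(x-1) e^(-t) - t^x e^(-t) and t^x e^(-t) vanishes at both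
    ends, convergence at [x + 1] implies convergence at [x], which also covers
    exponents for which the integrand is unbounded at 0. *)
Lemma is_RInt_gen_by_parts (x : R) :
  0 < x ->
  is_RInt_gen (euler_integrand x) (at_right 0) (Rbar_locally p_infty)
    (Gamma (x + 1) / x).
Proof.
intros Hx.
destruct (Gamma_spec_ge_1 (x + 1)) as [Hint _]; [lra |].
(* Eventually the segment lies in (0, +oo), where the integrand is smooth. *)
assert (Hcompact : forall P : R -> Prop, (forall t, 0 < t -> P t) ->
  filter_prod (at_right 0) (Rbar_locally p_infty)
    (fun ab => forall t, Rmin (fst ab) (snd ab) <= t <= Rmax (fst ab) (snd ab) ->
       P t)).
{ intros P HP.
  apply (Filter_prod _ _ _ (fun a => 0 < a) (fun b => 0 < b)).
  - now exists (mkposreal 1 Rlt_0_1).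
  - now exists 0.
  - intros a b Ha Hb t [Ht _]; apply HP; simpl in Ht.
    apply Rlt_le_trans with (2 := Ht); now apply Rmin_pos. }
assert (HD : forall t, 0 < t -> Derive (euler_integrand (x + 1)) t
               = x * euler_integrand x t - euler_integrand (x + 1) t).
{ intros t Ht; apply is_derive_unique; now apply is_derive_euler_integrand. }
assert (Hbdry : is_RInt_gen (Derive (euler_integrand (x + 1)))
                  (at_right 0) (Rbar_locally p_infty) (0 - 0)).
{ apply is_RInt_gen_Derive.
  - apply Hcompact; intros t Ht; eexists; now apply is_derive_euler_integrand.
  - apply Hcompact; intros t Ht.
    apply (continuous_ext_loc _
             (fun t => x * euler_integrand x t - euler_integrand (x + 1) t)).
    + exists (mkposreal t Ht); intros y Hy; symmetry; apply HD.
      apply Rabs_lt_between' in Hy; simpl in Hy; lra.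
    + apply (continuous_minus (fun t => x * euler_integrand x t)).
      * apply (continuous_scal_r x (euler_integrand x)).
        now apply continuous_euler_integrand.
      * now apply continuous_euler_integrand.
  - now apply euler_integrand_lim_0.
  - apply euler_integrand_lim_infty; lra. }
generalize (is_RInt_gen_scal _ (/ x) _ (is_RInt_gen_plus _ _ _ _ Hbdry Hint)).
intros H; replace (Gamma (x + 1) / x)
  with (scal (/ x) (plus (0 - 0) (Gamma (x + 1)))).
2: { unfold scal, plus; simpl; unfold mult; simpl; field; lra. }
revert H; apply is_RInt_gen_ext.
generalize (Hcompact _ HD); apply filter_imp.
intros [a b] Hab t Ht; rewrite Hab by (simpl in *; lra).
unfold scal, plus; simpl; unfold mult; simpl; field; lra.
Qed.

(** * Functional equation and positivity of Gamma *)

Lemma Gamma_succ (x : R) : 0 < x -> Gamma (x + 1) = x * Gamma x.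
Proof.
intros Hx.
replace (Gamma x) with (Gamma (x + 1) / x); [field; lra |].
symmetry; apply Gamma_unique; now apply is_RInt_gen_by_parts.
Qed.

Lemma Gamma_pos (x : R) : 0 < x -> 0 < Gamma x.
Proof.
intros Hx.
destruct (Gamma_spec_ge_1 (x + 1)) as [_ H]; [lra |].
rewrite (Gamma_succ x Hx) in H.
now apply Rmult_lt_reg_l with (1 := Hx); rewrite Rmult_0_r.
Qed.

(** * The entire factor of the Bessel function *)

Definition bessel_coeff (nu : R) (k : nat) : R :=
  / (INR (fact k) * Gamma (INR k + nu + 1)).

Definition bessel_entire (nu : R) : R -> R := PSeries (bessel_coeff nu).

Lemma bessel_coeff_pos (nu : R) (k : nat) : -1 < nu -> 0 < bessel_coeff nu k.
Proof.
intros Hnu; apply Rinv_0_lt_compat, Rmult_lt_0_compat; [apply INR_fact_lt_0 |].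
apply Gamma_pos; generalize (pos_INR k); lra.
Qed.

(** Termwise differentiation raises the order by one: [k + 1] cancels against
    the factorial, and the Gamma factor is unchanged. *)
Lemma bessel_coeff_shift (nu : R) (k : nat) :
  -1 < nu ->
  INR (S k) * bessel_coeff nu (S k) = bessel_coeff (nu + 1) k.
Proof.
intros Hnu; unfold bessel_coeff.
rewrite fact_simpl, mult_INR.
replace (INR (S k) + nu + 1) with (INR k + (nu + 1) + 1) by (rewrite S_INR; ring).
assert (HG : 0 < Gamma (INR k + (nu + 1) + 1)).
{ apply Gamma_pos; generalize (pos_INR k); lra. }
generalize (INR_fact_lt_0 k) (lt_0_INR (S k) (Nat.lt_0_succ k)); intros Hf Hk.
field; repeat split; lra.
Qed.

(** The functional equation of Gamma at [k + nu + 1]. *)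
Lemma bessel_coeff_order (nu : R) (k : nat) :
  -1 < nu -> bessel_coeff nu k = (INR k + nu + 1) * bessel_coeff (nu + 1) k.
Proof.
intros Hnu; unfold bessel_coeff.
assert (Hk : 0 < INR k + nu + 1) by (generalize (pos_INR k); lra).
replace (INR k + (nu + 1) + 1) with (INR k + nu + 1 + 1) by ring.
rewrite (Gamma_succ (INR k + nu + 1) Hk).
assert (HG : 0 < Gamma (INR k + nu + 1)) by now apply Gamma_pos.
generalize (INR_fact_lt_0 k); intros Hf.
field; repeat split; lra.
Qed.

Lemma CV_radius_bessel_coeff (nu : R) :
  -1 < nu -> CV_radius (bessel_coeff nu) = p_infty.
Proof.
intros Hnu; apply CV_radius_infinite_DAlembert.
- intros k; now apply Rgt_not_eq, bessel_coeff_pos.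
- assert (Hratio : forall k, Rabs (bessel_coeff nu (S k) / bessel_coeff nu k)
                     = / INR (S k) * / (INR (S k) + nu)).
  { intros k; rewrite (bessel_coeff_order nu k Hnu), <- (bessel_coeff_shift nu k Hnu).
    generalize (bessel_coeff_pos nu (S k) Hnu) (pos_INR k); rewrite S_INR.
    intros Hc Hk.
    rewrite Rabs_pos_eq.
    - field; repeat split; lra.
    - left; apply Rdiv_lt_0_compat; [lra |].
      repeat apply Rmult_lt_0_compat; lra. }
  apply (is_lim_seq_le_le (fun _ => 0) _ (fun k => / INR (S k) * / (1 + nu))).
  + intros k; rewrite Hratio; generalize (pos_INR k); rewrite S_INR; intros Hk.
    assert (H1 : 0 < / (INR k + 1)) by (apply Rinv_0_lt_compat; lra).
    split.
    * left; apply Rmult_lt_0_compat; [easy | apply Rinv_0_lt_compat; lra].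
    * apply Rmult_le_compat_l; [lra |]; apply Rinv_le_contravar; lra.
  + apply is_lim_seq_const.
  + replace (Finite 0) with (Rbar_mult 0 (/ (1 + nu))) by (simpl; f_equal; ring).
    apply is_lim_seq_scal_r.
    replace (Finite 0) with (Rbar_inv p_infty) by easy.
    apply is_lim_seq_inv; [| easy].
    apply (is_lim_seq_incr_1 INR), is_lim_seq_INR.
Qed.

Lemma ex_pseries_bessel (nu x : R) :
  -1 < nu -> ex_pseries (bessel_coeff nu) x.
Proof.
intros Hnu; apply CV_radius_inside; now rewrite CV_radius_bessel_coeff.
Qed.

(** The constant coefficient is positive and the remaining terms are
    nonnegative. *)
Lemma bessel_entire_pos (nu x : R) : -1 < nu -> 0 <= x -> 0 < bessel_entire nu x.
Proof.
intros Hnu Hx; unfold bessel_entire.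
rewrite PSeries_decr_1 by now apply ex_pseries_bessel.
apply Rplus_lt_le_0_compat; [now apply bessel_coeff_pos |].
apply Rmult_le_pos; [exact Hx |].
replace 0 with (Series (fun k => 0 * 0)) by (rewrite Series_scal_l; ring).
apply Series_le.
- intros k; rewrite Rmult_0_l; split; [apply Rle_refl |].
  apply Rmult_le_pos; [left; now apply bessel_coeff_pos | now apply pow_le].
- apply (ex_series_ext (fun k => scal (pow_n x k) (PS_decr_1 (bessel_coeff nu) k))).
  { intros k; rewrite pow_n_pow; apply Rmult_comm. }
  apply (CV_radius_inside (PS_decr_1 (bessel_coeff nu)) x).
  now rewrite CV_radius_decr_1, CV_radius_bessel_coeff.
Qed.

Lemma is_derive_bessel_entire (nu x : R) :
  -1 < nu -> is_derive (bessel_entire nu) x (bessel_entire (nu + 1) x).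
Proof.
intros Hnu; unfold bessel_entire.
rewrite <- (PSeries_ext (PS_derive (bessel_coeff nu))).
- apply is_derive_PSeries; now rewrite CV_radius_bessel_coeff.
- intros k; now apply bessel_coeff_shift.
Qed.

(** The coefficient of x^k for order [nu] is [k + nu + 1] times that for
    [nu + 1]. The factor [nu + 1] gives the second term; the factor [k] acts as
    x d/dx, which raises the order again and gives the first. *)
Lemma bessel_entire_recurrence (nu x : R) :
  -1 < nu ->
  bessel_entire nu x
    = x * bessel_entire (nu + 1 + 1) x + (nu + 1) * bessel_entire (nu + 1) x.
Proof.
intros Hnu; unfold bessel_entire.
rewrite <- PSeries_incr_1, <- PSeries_scal, <- PSeries_plus.
- apply PSeries_ext; intros k; rewrite (bessel_coeff_order nu k Hnu).
  unfold PS_plus, PS_scal, PS_incr_1, plus, scal, zero; simpl; unfold mult; simpl.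
  destruct k as [| k]; [simpl; ring |].
  rewrite <- (bessel_coeff_shift (nu + 1) k) by lra; ring.
- apply ex_pseries_incr_1, ex_pseries_bessel; lra.
- apply ex_pseries_scal; [apply Rmult_comm | apply ex_pseries_bessel; lra].
Qed.

(** * Bessel functions: positivity and recurrences *)

Lemma bessel_I_entire (nu u : R) :
  0 < u -> bessel_I nu u = Rpower (u / 2) nu * bessel_entire nu (u ^ 2 / 4).
Proof.
intros Hu; unfold bessel_I, bessel_entire, PSeries.
rewrite <- Series_scal_l; apply Series_ext; intros k.
assert (Hu2 : 0 < u / 2) by lra.
rewrite Rpower_plus.
replace (2 * INR k) with (INR (2 * k)) by now rewrite mult_INR.
rewrite Rpower_pow, pow_mult by easy.
replace ((u / 2) ^ 2) with (u ^ 2 / 4) by field.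
unfold bessel_coeff, Rdiv; ring.
Qed.

Lemma bessel_I_pos (nu u : R) : -1 < nu -> 0 < u -> 0 < bessel_I nu u.
Proof.
intros Hnu Hu; rewrite bessel_I_entire by easy.
apply Rmult_lt_0_compat; [apply exp_pos |].
apply bessel_entire_pos; [easy |].
generalize (pow2_ge_0 u); lra.
Qed.

Lemma bessel_I_recurrence (nu u : R) :
  -1 < nu -> 0 < u ->
  bessel_I nu u = bessel_I (nu + 1 + 1) u + 2 * (nu + 1) / u * bessel_I (nu + 1) u.
Proof.
intros Hnu Hu; rewrite !bessel_I_entire, (bessel_entire_recurrence nu) by easy.
rewrite !Rpower_plus, Rpower_1 by lra.
field; lra.
Qed.

Lemma is_derive_bessel_I (nu u : R) :
  -1 < nu -> 0 < u ->
  is_derive (bessel_I nu) u (nu / u * bessel_I nu u + bessel_I (nu + 1) u).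
Proof.
intros Hnu Hu.
apply (is_derive_ext_loc
         (fun v => Rpower (v / 2) nu * bessel_entire nu (v ^ 2 / 4))).
{ exists (mkposreal u Hu); intros v Hv; symmetry; apply bessel_I_entire.
  apply Rabs_lt_between' in Hv; simpl in Hv; lra. }
assert (Hpow : is_derive (fun v => Rpower (v / 2) nu) u
                 (nu / u * Rpower (u / 2) nu)).
{ unfold Rpower; auto_derive; [lra | unfold Rdiv; field; lra]. }
assert (Hent : is_derive (fun v => bessel_entire nu (v ^ 2 / 4)) u
                 (u / 2 * bessel_entire (nu + 1) (u ^ 2 / 4))).
{ apply (is_derive_comp (bessel_entire nu) (fun v => v ^ 2 / 4)).
  - now apply is_derive_bessel_entire.
  - auto_derive; [easy | field]. }
rewrite !bessel_I_entire, Rpower_plus, Rpower_1 by lra.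
evar_last.
apply (is_derive_mult _ _ _ _ _ Hpow Hent).
intros; apply Rmult_comm.
unfold plus, mult; simpl; ring.
Qed.

(** The derivative formula at order [nu + 1], with [I_(nu+2)] eliminated by the
    three-term recurrence so that only the two functions entering [bessel_q]
    remain. *)
Lemma is_derive_bessel_I_succ (nu u : R) :
  -1 < nu -> 0 < u ->
  is_derive (bessel_I (nu + 1)) u
    (bessel_I nu u - (nu + 1) / u * bessel_I (nu + 1) u).
Proof.
intros Hnu Hu.
rewrite (bessel_I_recurrence nu u) by easy.
evar_last; [apply is_derive_bessel_I; lra | field; lra].
Qed.

(** * Logarithmic derivatives *)

Lemma bessel_r_q (nu u : R) :
  -1 < nu -> 0 < u -> bessel_r nu u = nu / u + bessel_q nu u.
Proof.
intros Hnu Hu; unfold bessel_r, bessel_q.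
rewrite (is_derive_unique _ _ _ (is_derive_bessel_I nu u Hnu Hu)).
generalize (bessel_I_pos nu u Hnu Hu); intros H; field; lra.
Qed.

(** A Riccati equation: the pair of first-order linear equations for
    [I_nu] and [I_(nu+1)] induces a first-order equation, quadratic
    in [q], for their quotient. *)
Lemma is_derive_bessel_q (nu u : R) :
  -1 < nu -> 0 < u ->
  is_derive (bessel_q nu) u
    (1 - bessel_q nu u ^ 2 - (2 * nu + 1) * bessel_q nu u / u).
Proof.
intros Hnu Hu; generalize (bessel_I_pos nu u Hnu Hu); intros HI.
evar_last.
apply is_derive_div.
now apply is_derive_bessel_I_succ.
now apply is_derive_bessel_I.
lra.
unfold bessel_q; field; lra.
Qed.

Lemma bessel_g_split (nu u : R) :
  -1 < nu -> 0 < u -> bessel_g nu u = ln u / 2 + ln (bessel_I nu u).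
Proof.
intros Hnu Hu; unfold bessel_g.
rewrite ln_mult by (try apply bessel_I_pos; try apply sqrt_lt_R0; easy).
rewrite <- (sqrt_sqrt u) at 3 by lra.
rewrite ln_mult by now apply sqrt_lt_R0.
field.
Qed.

Lemma is_derive_bessel_g (nu u : R) :
  -1 < nu -> 0 < u ->
  is_derive (bessel_g nu) u ((nu + 1 / 2) / u + bessel_q nu u).
Proof.
intros Hnu Hu; generalize (bessel_I_pos nu u Hnu Hu); intros HI.
generalize (is_derive_bessel_I nu u Hnu Hu); intros HdI.
apply (is_derive_ext_loc (fun v => ln v / 2 + ln (bessel_I nu v))).
{ exists (mkposreal u Hu); intros v Hv; symmetry; apply bessel_g_split; [easy |].
  apply Rabs_lt_between' in Hv; simpl in Hv; lra. }
auto_derive.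
- repeat split; try easy; eexists; exact HdI.
- replace (Derive _ u) with (nu / u * bessel_I nu u + bessel_I (nu + 1) u)
    by (symmetry; now apply is_derive_unique).
  unfold bessel_q; field; lra.
Qed.

Lemma is_derive_n_bessel_g_2 (nu u : R) :
  -1 < nu -> 0 < u ->
  is_derive_n (bessel_g nu) 2 u
    (1 - bessel_q nu u ^ 2 - (2 * nu + 1) * bessel_q nu u / u
       - (nu + 1 / 2) / u ^ 2).
Proof.
intros Hnu Hu; simpl.
apply (is_derive_ext_loc (fun v => (nu + 1 / 2) / v + bessel_q nu v)).
{ exists (mkposreal u Hu); intros v Hv; symmetry; apply is_derive_unique.
  apply is_derive_bessel_g; [easy |].
  apply Rabs_lt_between' in Hv; simpl in Hv; lra. }
evar_last.
apply (is_derive_plus (fun v => (nu + 1 / 2) / v) (bessel_q nu)).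
{ auto_derive; [lra | reflexivity]. }
now apply is_derive_bessel_q.
unfold plus; simpl; field; lra.
Qed.

(* [Derive] and [Derive_n] are total, so the differentiability that the
   notations [I_nu'] and [g_nu''] presuppose is asserted explicitly. *)
Theorem lemma2p4 :
  forall (nu u : R), 0 <= nu -> 0 < u ->
    (ex_derive (bessel_I nu) u /\
     ex_derive_n (bessel_g nu) 1 u /\
     ex_derive_n (bessel_g nu) 2 u) /\
    Derive_n (bessel_g nu) 2 u
      = 1 + (nu ^ 2 - 1 / 2) / u ^ 2 - bessel_r nu u / u - bessel_r nu u ^ 2 /\
    Derive_n (bessel_g nu) 2 u
      = 1 - bessel_q nu u ^ 2 - (2 * nu + 1) * bessel_q nu u / u
          - (nu + 1 / 2) / u ^ 2 /\
    (Derive_n (bessel_g nu) 2 u < 0 <->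
     1 + (nu ^ 2 - 1 / 2) / u ^ 2 - bessel_r nu u / u - bessel_r nu u ^ 2 < 0) /\
    (1 + (nu ^ 2 - 1 / 2) / u ^ 2 - bessel_r nu u / u - bessel_r nu u ^ 2 < 0 <->
     bessel_q nu u ^ 2 + (2 * nu + 1) * bessel_q nu u / u
       + (nu + 1 / 2) / u ^ 2 > 1).
Proof.
intros nu u Hnu Hu.
assert (Hnu1 : -1 < nu) by lra.
generalize (is_derive_n_bessel_g_2 nu u Hnu1 Hu); intros Hg2.
assert (Hform : 1 + (nu ^ 2 - 1 / 2) / u ^ 2 - bessel_r nu u / u - bessel_r nu u ^ 2
  = 1 - bessel_q nu u ^ 2 - (2 * nu + 1) * bessel_q nu u / u
      - (nu + 1 / 2) / u ^ 2).
{ rewrite bessel_r_q by easy; field; lra. }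
rewrite (is_derive_n_unique _ _ _ _ Hg2), Hform.
repeat split; try easy; try lra.
- eexists; now apply is_derive_bessel_I.
- eexists; now apply is_derive_bessel_g.
- eexists; exact Hg2.
Qed.
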